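(* Let $L>0$ and let $f:\mathbb{R}^n\to\mathbb{R}$ be a convex $L$-smooth function. Let $0<\eta\le1/L$, $x^0\in\mathbb{R}^n$, and let $x^{k+1}=x^k-\eta\nabla f(x^k)$ for $k\ge0$ (gradient descent). Set $\bar x^k=\frac1k\sum_{i=1}^kx^i$. Then for every $k\ge1$ and every $x\in\mathrm{dom}(f)=\mathbb{R}^n$, $$f(\bar x^k)-f(x)\le\frac{\|x-x^0\|^2}{2\eta k}.$$
   Context: $f$ is $L$-smooth if it is differentiable and $\nabla f$ is $L$-Lipschitz continuous with respect to the Euclidean norm $\|\cdot\|$. *)

(* Defs.v *)
From mathcomp Require Import all_boot all_order all_algebra.
From mathcomp Require Import all_classical all_reals all_analysis.

Set Implicit Arguments.
Unset Strict Implicit.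
Unset Printing Implicit Defensive.

Import Order.TTheory GRing.Theory Num.Theory.
Import numFieldNormedType.Exports.

Local Open Scope ring_scope.

(* The norm `|x| that the library puts on 'rV[R]_n is the sup norm; it gives the
   same differentiable functions, but Lipschitz constants depend on the norm. *)
Definition enorm (R : realType) (n : nat) (x : 'rV[R]_n) : R :=
  Num.sqrt (\sum_(i < n) x ord0 i ^+ 2).

Definition gradient (R : realType) (n : nat) (f : 'rV[R]_n -> R) (x : 'rV[R]_n)
    : 'rV[R]_n :=
  \row_(i < n) 'D_(delta_mx ord0 i) (f : 'rV[R]_n -> R^o) x.

Definition smooth (R : realType) (n : nat) (L : R) (f : 'rV[R]_n -> R) : Prop :=
  (forall x : 'rV[R]_n, differentiable (f : 'rV[R]_n -> R^o) x) /\
  (forall x y : 'rV[R]_n,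
     enorm (gradient f x - gradient f y) <= L * enorm (x - y)).

(* Main.v *)
Require Import Defs.
From mathcomp Require Import all_boot all_order all_algebra.
From mathcomp Require Import all_classical all_reals all_analysis.
From mathcomp Require Import ring lra.

(** Write <u, v> for the Euclidean inner product and g = gradient f y.
    Convexity and smoothness bound f from below and from above by its
    tangents: f x >= f y + <g, x - y> ([convex_ge_tangent]), and
    f z <= f y + <g, z - y> + L/2 |z - y|^2 ([smooth_le_quadratic]).
    For a gradient step z = y - eta g, both bounds together give
    f z - f x <= - <g, x - y> - eta (1 - eta L / 2) |g|^2, and since
    eta L <= 1 the last coefficient may be replaced by eta / 2.  Then the
    right-hand side is exactly (|x - y|^2 - |x - z|^2) / (2 eta): this is
    [gradient_step_le].

    Along the iterates these bounds telescope, so the sum of f (x^i) - f x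
    over i = 1..k is at most |x - x^0|^2 / (2 eta).  It remains to pass from
    the mean of the values to the value at the mean, which is Jensen's
    inequality ([convex_mean_le]). *)

Set Implicit Arguments.
Unset Strict Implicit.
Unset Printing Implicit Defensive.

Import Order.TTheory GRing.Theory Num.Theory.
Import numFieldNormedType.Exports.

Local Open Scope classical_set_scope.
Local Open Scope ring_scope.

Definition dot {R : realType} {n : nat} (u v : 'rV[R]_n) : R :=
  \sum_(i < n) u ord0 i * v ord0 i.

Lemma enorm_sqr (R : realType) (n : nat) (u : 'rV[R]_n) :
  enorm u ^+ 2 = dot u u.
Proof.
rewrite /enorm sqr_sqrtr; last by apply: sumr_ge0 => i _; exact: sqr_ge0.
by apply: eq_bigr => i _; rewrite expr2.
Qed.

Lemma enorm_ge0 (R : realType) (n : nat) (u : 'rV[R]_n) : 0 <= enorm u.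
Proof. exact: sqrtr_ge0. Qed.

Lemma enormZ (R : realType) (n : nat) (a : R) (u : 'rV[R]_n) :
  enorm (a *: u) = `|a| * enorm u.
Proof.
rewrite -sqrtr_sqr -sqrtrM ?sqr_ge0//; congr Num.sqrt; rewrite mulr_sumr.
by apply: eq_bigr => i _; rewrite mxE exprMn.
Qed.

Lemma dotC (R : realType) (n : nat) (u v : 'rV[R]_n) : dot u v = dot v u.
Proof. by apply: eq_bigr => i _; rewrite mulrC. Qed.

Lemma dotDl (R : realType) (n : nat) (u v w : 'rV[R]_n) :
  dot (u + v) w = dot u w + dot v w.
Proof. by rewrite -big_split; apply: eq_bigr => i _; rewrite !mxE mulrDl. Qed.

Lemma dotZl (R : realType) (n : nat) (a : R) (u v : 'rV[R]_n) :
  dot (a *: u) v = a * dot u v.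
Proof. by rewrite mulr_sumr; apply: eq_bigr => i _; rewrite !mxE mulrA. Qed.

Lemma dotNl (R : realType) (n : nat) (u v : 'rV[R]_n) :
  dot (- u) v = - dot u v.
Proof. by rewrite -scaleN1r dotZl mulN1r. Qed.

Lemma dotDr (R : realType) (n : nat) (u v w : 'rV[R]_n) :
  dot w (u + v) = dot w u + dot w v.
Proof. by rewrite dotC dotDl !(dotC _ w). Qed.

Lemma dotZr (R : realType) (n : nat) (a : R) (u v : 'rV[R]_n) :
  dot u (a *: v) = a * dot u v.
Proof. by rewrite dotC dotZl dotC. Qed.

Lemma dotNr (R : realType) (n : nat) (u v : 'rV[R]_n) :
  dot u (- v) = - dot u v.
Proof. by rewrite dotC dotNl dotC. Qed.

Definition dotE := (dotDl, dotDr, dotZl, dotZr, dotNl, dotNr).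

(** The form of the Cauchy-Schwarz inequality that a Lipschitz bound needs.
    No square root has to be handled: 0 <= |u - c v|^2 and |u|^2 <= c^2 |v|^2
    give 2 c <u, v> <= 2 c^2 |v|^2. *)
Lemma dot_le_enorm (R : realType) (n : nat) (c : R) (u v : 'rV[R]_n) :
  0 < c -> enorm u <= c * enorm v -> dot u v <= c * enorm v ^+ 2.
Proof.
move=> c0 uv.
have : enorm u ^+ 2 <= (c * enorm v) ^+ 2.
  by rewrite lerXn2r// nnegrE ?mulr_ge0 ?enorm_ge0// ltW.
have : 0 <= enorm (u - c *: v) ^+ 2 by exact: sqr_ge0.
rewrite exprMn !enorm_sqr !dotE (dotC v u) => h1 h2.
rewrite -(ler_pM2l c0); nra.
Qed.

(** The gradient consists of partial derivatives; differentiability, that is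
    linearity of the differential, is what makes it represent all the
    directional derivatives. *)
Lemma derive_dot_gradient (R : realType) (n : nat) (f : 'rV[R]_n -> R)
    (x v : 'rV[R]_n) :
  differentiable (f : 'rV[R]_n -> R^o) x ->
  'D_v (f : 'rV[R]_n -> R^o) x = dot (gradient f x) v.
Proof.
move=> df; rewrite deriveE// {1}(row_sum_delta v) linear_sum.
apply: eq_bigr => i _; rewrite linearZ mxE deriveE//.
by rewrite mulrC.
Qed.

(** The difference quotient of s |-> f (x + s v) at t is the one of f at
    x + t v in the direction v. *)
Lemma is_derive_line (R : realType) (n : nat) (f : 'rV[R]_n -> R)
    (x v : 'rV[R]_n) (t : R) :
  differentiable (f : 'rV[R]_n -> R^o) (x + t *: v) ->
  is_derive t (1 : R) (fun s : R => f (x + s *: v) : R)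
    (dot (gradient f (x + t *: v)) v).
Proof.
move=> df; have dv := diff_derivable (v := v) df.
have E : (fun h : R => h^-1 *: (((fun s : R => f (x + s *: v)) \o shift t)
            (h *: (1 : R)) - f (x + t *: v))) =
    (fun h : R => h^-1 *: ((f \o shift (x + t *: v)) (h *: v)
            - f (x + t *: v))).
  apply/funext => h /=; congr (_ *: (f _ - _)).
  by rewrite [h *: 1]mulr1 scalerDl addrCA.
split; first by rewrite /derivable E.
by rewrite -derive_dot_gradient// /derive E.
Qed.

(** By convexity the slope (f (x + h (y - x)) - f x) / h of a chord is at most
    f y - f x for 0 < h <= 1, and it tends to <gradient f x, y - x> as h
    tends to 0 from the right. *)
Lemma convex_ge_tangent (R : realType) (n : nat) (f : 'rV[R]_n -> R)
    (x y : 'rV[R]_n) :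
  convex_function [set: 'rV[R]_n] f ->
  differentiable (f : 'rV[R]_n -> R^o) x ->
  f x + dot (gradient f x) (y - x) <= f y.
Proof.
move=> cf df; rewrite -lerBrDl -derive_dot_gradient//.
have dv := diff_derivable (v := y - x) df.
apply: (cvgr_to_le (cvg_dnbhs_at_right dv)).
near=> h.
have h0 : 0 < h by [].
have h1 : h <= 1 by near: h; apply: nbhs_right_le.
(* Packages h as an interval-typed weight, as convex combinations require. *)
have h01 : Itv.spec (@Itv.num_sem R) (Itv.Real `[0%Z, 1%Z]) h.
  by rewrite /= /Itv.num_sem num_real /= in_itv /= (ltW h0) h1.
have /= := cf (Itv.mk h01) y x (in_setT _) (in_setT _).
rewrite convRE /conv /= /unstable.onem.
have -> : h *: y + (1 - h) *: x = h *: (y - x) + x.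
  by rewrite scalerBr scalerBl scale1r addrAC addrA.
move=> chord; rewrite [leLHS]/(_ * _) ler_pdivrMl//; lra.
Unshelve. all: by end_near. Qed.

(** With v = y - x, the function
    h t = f (x + t v) - (t <gradient f x, v> + t^2 (L/2 |v|^2)) has derivative
    <gradient f (x + t v) - gradient f x, v> - t L |v|^2, which the Lipschitz
    bound makes nonpositive for t > 0.  The mean value theorem then yields
    h 1 <= h 0, which is the claim. *)
Lemma smooth_le_quadratic (R : realType) (n : nat) (L : R)
    (f : 'rV[R]_n -> R) (x y : 'rV[R]_n) :
  0 < L -> smooth L f ->
  f y <= f x + dot (gradient f x) (y - x) + L / 2 * enorm (y - x) ^+ 2.
Proof.
move=> L0 [df lf]; set v := y - x.
(* Written with operations on functions, not pointwise, so that the rules for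
   derivatives apply to it by instance resolution. *)
pose h : R -> R := (fun s : R => f (x + s *: v) : R)
  - (dot (gradient f x) v \*: id + (L / 2 * enorm v ^+ 2) \*: (id ^+ 2)).
pose dh (t : R) : R := dot (gradient f (x + t *: v)) v
  - (dot (gradient f x) v + t * L * enorm v ^+ 2).
have dhP t : is_derive t (1 : R) h (dh t).
  have line := is_derive_line (df (x + t *: v)).
  apply: is_derive_eq; rewrite /dh.
  by rewrite /GRing.scale /=; field.
have [c c01] := @MVT R h dh 0 1 ltr01 (fun t _ => dhP t)
  (derivable_within_continuous (fun t _ => @ex_derive _ _ _ _ _ _ _ (dhP t))).
have c0 : 0 < c by rewrite (itvP c01).
have slope_le : dh c <= 0.
  rewrite /dh opprD addrA -dotNl -dotDl subr_le0 (mulrC c).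
  apply: dot_le_enorm; first by rewrite mulr_gt0.
  apply: le_trans (lf _ _) _.
  by rewrite addrAC subrr add0r enormZ gtr0_norm// mulrA.
rewrite subr0 mulr1 => hE; move: slope_le; rewrite -hE subr_le0.
have hE_at t : h t = f (x + t *: v)
    - (dot (gradient f x) v * t + L / 2 * enorm v ^+ 2 * t ^+ 2) by [].
rewrite !hE_at scale1r scale0r addr0 [x + v]addrC subrK; lra.
Qed.

(** Jensen's inequality with uniform weights.  Summing the tangent bound at the
    mean m over the points suffices, since the points minus m add up to 0 and
    hence the linear terms cancel. *)
Lemma convex_mean_le (R : realType) (n : nat) (f : 'rV[R]_n -> R)
    (xs : nat -> 'rV[R]_n) (k : nat) :
  let m := k%:R^-1 *: \sum_(1 <= i < k.+1) xs i in
  (0 < k)%N ->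
  convex_function [set: 'rV[R]_n] f ->
  differentiable (f : 'rV[R]_n -> R^o) m ->
  k%:R * f m <= \sum_(1 <= i < k.+1) f (xs i).
Proof.
move=> m k0 cf df.
have dot_sum u : \sum_(1 <= i < k.+1) dot u (xs i) = k%:R * dot u m.
  rewrite -dotZr scalerA divff ?pnatr_eq0 -?lt0n// scale1r.
  elim/big_rec2: _ => [|i a b _ ->]; last by rewrite dotDr.
  by rewrite /dot big1 // => i _; rewrite mxE mulr0.
apply: (@le_trans _ _
  (\sum_(1 <= i < k.+1) (f m + dot (gradient f m) (xs i - m)))); last first.
  by apply: ler_sum => i _; exact: convex_ge_tangent.
rewrite big_split /=; under [X in _ <= _ + X]eq_bigr do rewrite dotDr.
rewrite big_split /= dot_sum dotNr !sumr_const_nat subn1 /=.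
by rewrite -(mulr_natl (f m)) mulNrn -(mulr_natl (dot _ m)) subrr addr0.
Qed.

(** The two tangent bounds at y, added; completing the square in
    |x - y + eta g|^2 = |x - z|^2 then turns the inner product <g, x - y> into
    a difference of squared distances, a form that telescopes. *)
Lemma gradient_step_le (R : realType) (n : nat) (L : R) (f : 'rV[R]_n -> R)
    (eta : R) (x y z : 'rV[R]_n) :
  0 < L -> convex_function [set: 'rV[R]_n] f -> smooth L f ->
  0 < eta -> eta <= 1 / L -> z = y - eta *: gradient f y ->
  2 * eta * (f z - f x) <= enorm (x - y) ^+ 2 - enorm (x - z) ^+ 2.
Proof.
move=> L0 cf sf e0 eL zE; have [df _] := sf.
have up := smooth_le_quadratic y z L0 sf.
have lo := convex_ge_tangent x cf (df y).
have eL1 : eta * L <= 1 by rewrite -ler_pdivlMr.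
have xzE : x - z = (x - y) + eta *: gradient f y.
  by rewrite zE opprB addrA addrAC.
have zyE : z - y = - (eta *: gradient f y) by rewrite zE addrAC subrr add0r.
move: up lo; rewrite xzE zyE; move: (x - y) (gradient f y) => w g.
rewrite !enorm_sqr !dotE (dotC g w) => up lo.
have g_ge0 : 0 <= dot g g by rewrite -enorm_sqr sqr_ge0.
(* This is where eta <= 1 / L enters: the quadratic term
   L / 2 * |eta g|^2 is at most eta / 2 * |g|^2. *)
have curv : 0 <= (1 - eta * L) * (eta * dot g g).
  by rewrite mulr_ge0 ?subr_ge0 ?mulr_ge0// ltW.
have gap : f z - f x <= - dot w g - eta * dot g g / 2 by lra.
have : 0 < 2 * eta by rewrite mulr_gt0.
by move/ler_pM2l/(_ (f z - f x) (- dot w g - eta * dot g g / 2)); lra.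
Qed.

Theorem corollary4 (R : realType) (n : nat) (L : R) (f : 'rV[R]_n -> R)
    (eta : R) (x0 : 'rV[R]_n) (xs : nat -> 'rV[R]_n)
    (L_gt0 : 0 < L)
    (f_convex : convex_function [set: 'rV[R]_n] f)
    (f_smooth : smooth L f)
    (eta_gt0 : 0 < eta) (eta_le : eta <= 1 / L)
    (xs_init : xs 0%N = x0)
    (xs_step : forall k : nat, xs k.+1 = xs k - eta *: gradient f (xs k))
    (k : nat) (k_ge1 : (1 <= k)%N) (x : 'rV[R]_n) :
  f (k%:R^-1 *: \sum_(1 <= i < k.+1) xs i) - f x
    <= enorm (x - x0) ^+ 2 / (2 * eta * k%:R).
Proof.
have [df _] := f_smooth.
have k_gt0 : 0 < k%:R :> R by rewrite ltr0n.
have mean_le := convex_mean_le (xs := xs) k_ge1 f_convex (df _).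
have sum_le : 2 * eta * \sum_(1 <= i < k.+1) (f (xs i) - f x)
    <= enorm (x - xs 0%N) ^+ 2 - enorm (x - xs k) ^+ 2.
  rewrite mulr_sumr big_add1/=.
  rewrite -[leRHS]opprB -(telescope_sumr (fun i => enorm (x - xs i) ^+ 2))//.
  rewrite -sumrN; apply: ler_sum => i _; rewrite opprB.
  exact: (@gradient_step_le _ _ L).
move: sum_le; rewrite sumrB sumr_const_nat subn1/= -(mulr_natl (f x)) xs_init.
move=> sum_le.
rewrite ler_pdivlMr; last by rewrite !mulr_gt0.
have := sqr_ge0 (enorm (x - xs k)).
move: mean_le; set m := f (_ *: _) => mean_le.
have : 2 * eta * (k%:R * m) <= 2 * eta * (\sum_(1 <= i < k.+1) f (xs i)).
  by rewrite ler_pM2l// mulr_gt0.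
lra.
Qed.
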